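(* Let $A \in \mathbb{R}^{n\times n}$ and $C \in \mathbb{R}^{m\times n}$. Suppose that the set $$\bigcup_{t \ge 0} (\ker Ce^{At})^{\perp} = \bigcup_{t\ge 0} \operatorname{Im}\,(Ce^{At})^{\top}$$ is not contained in a proper algebraic subvariety of $\mathbb{R}^n$. Then the linear system $(A,C)$ is ensemble observable for the class of initial distributions $\mathbb{P}_0$ on $\mathbb{R}^n$ such that, for $X_0 \sim \mathbb{P}_0$ and for every non-zero $v \in \mathbb{R}^n$, the function $\mathbb{R} \to \mathbb{C}$, $s \mapsto \varphi_{X_0}(sv)$, is real analytic.
   Context: The linear system $(A,C)$ is $\dot x(t) = Ax(t)$, $y(t) = Cx(t)$, $x(0)=x_0$, with $A\in\mathbb{R}^{n\times n}$, $C\in\mathbb{R}^{m\times n}$. If the initial state is a random vector with probability distribution $\mathbb{P}_0$ on $\mathbb{R}^n$, the output distribution at time $t\ge 0$, denoted $\mathbb{P}_{y(t)|\mathbb{P}_0}$, is the push-forward of $\mathbb{P}_0$ under the map $x \mapsto Ce^{At}x$, i.e. $\mathbb{P}_{y(t)|\mathbb{P}_0}(B) = \mathbb{P}_0((Ce^{At})^{-1}(B))$ for Borel sets $B\subset\mathbb{R}^m$. Given a class $\mathcal{K}$ of probability distributions on $\mathbb{R}^n$, the system $(A,C)$ is ensemble observable for the class $\mathcal{K}$ if for all continuous (i.e. admitting a density with respect to Lebesgue measure) distributions $\mathbb{P}_0', \mathbb{P}_0'' \in \mathcal{K}$: if $\mathbb{P}_{y(t)|\mathbb{P}_0'} = \mathbb{P}_{y(t)|\mathbb{P}_0''}$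 for all $t\ge 0$, then $\mathbb{P}_0' = \mathbb{P}_0''$. $\varphi_{X_0}(\xi) = \mathbb{E}\, e^{i\langle \xi, X_0\rangle}$ is the characteristic function. A function on $\mathbb{R}$ is real analytic if it can be locally written as a power series about every point of $\mathbb{R}$. An algebraic variety of $\mathbb{R}^n$ is the zero set in $\mathbb{R}^n$ of a real polynomial in $n$ variables; it is proper if it is not all of $\mathbb{R}^n$. *)

(* Defs.v *)
From HB Require Import structures.
From mathcomp Require Import all_boot all_order all_algebra.
From mathcomp Require Import all_classical all_reals all_analysis.
From mathcomp Require Import measurable_realfun complex.
From mathcomp Require mpoly.

Set Implicit Arguments.
Unset Strict Implicit.
Unset Printing Implicit Defensive.

Import Order.TTheory GRing.Theory Num.Theory.
Import numFieldNormedType.Exports.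

Local Open Scope classical_set_scope.
Local Open Scope ring_scope.
Local Open Scope complex_scope.

(* 'M[R]_(m, n) carries the Borel sigma-algebra of its (product) topology. *)
Section borel_matrix.
Variables (R : realType) (m n : nat).

HB.instance Definition _ := @isMeasurable.Build
  (sigma_display (@open 'M[R]_(m, n))) 'M[R]_(m, n)
  <<s @open 'M[R]_(m, n) >>
  (@sigma_algebra0 _ setT (@open 'M[R]_(m, n)))
  (@sigma_algebraC _ (@open 'M[R]_(m, n)))
  (@sigma_algebra_bigcup _ setT (@open 'M[R]_(m, n))).

End borel_matrix.

Lemma measurable_fun_cV (R : realType) d (T : measurableType d) n
    (f : T -> 'cV[R]_n) :
  (forall i, measurable_fun [set: T] (fun x => f x i ord0)) ->
  measurable_fun [set: T] f.
Proof.
move=> mf.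
pose box (q : 'cV[rat]_n * 'cV[rat]_n) : set 'cV[R]_n :=
  [set x | forall i, ratr (q.1 i ord0) < x i ord0 < ratr (q.2 i ord0)].
apply: (@measurability _ _ _ _ _ f (@open 'cV[R]_n)) => //.
move=> _ [U oU <-]; rewrite setTI.
have -> : U = \bigcup_(q in [set q | box q `<=` U]) box q.
  apply/seteqP; split => [x Ux|x [q /= qU qx]]; last exact: qU.
  have /nbhs_ballP[e /= e0 eU] : nbhs x U by exact: open_nbhs_nbhs.
  have /choice[a ha] i : exists q, ratr q \in `]x i ord0 - e, x i ord0[.
    by apply: rat_in_itvoo; rewrite ltrBlDr ltrDl.
  have /choice[b hb] i : exists q, ratr q \in `]x i ord0, x i ord0 + e[.
    by apply: rat_in_itvoo; rewrite ltrDl.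
  exists (\col_i a i, \col_i b i) => /=; last first.
    move=> i; rewrite !mxE.
    by have := ha i; have := hb i; rewrite !in_itv/= => /andP[-> _] /andP[_ ->].
  move=> y /= hy; apply: eU; split => // i j; rewrite (ord1 j).
  have := hy i; rewrite !mxE => /andP[ay yb].
  have := ha i; have := hb i; rewrite !in_itv/= => /andP[_ be] /andP[ae _].
  by rewrite /ball/= distrC ltr_distl (lt_trans ae ay) (lt_trans yb be).
rewrite preimage_bigcup bigcup_mkcond.
apply: countable_bigcupT_measurable => [|q]; first exact: countableP.
case: ifP => // _.
rewrite (_ : _ @^-1` _ = \bigcap_(i in [set: 'I_n])
  ((fun x => f x i ord0) @^-1` `]ratr (q.1 i ord0), ratr (q.2 i ord0)[)).
  apply: fin_bigcap_measurable => [|i _]; first exact: finite_finset.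
  by rewrite -[X in measurable X]setTI; exact: mf.
apply/seteqP; split => x /= hx i; first by move=> _; rewrite /= in_itv/=; exact: hx.
by have := hx i I; rewrite /= in_itv.
Qed.

Lemma measurable_coord_cV (R : realType) n (i : 'I_n) :
  measurable_fun [set: 'cV[R]_n] (fun x => x i ord0).
Proof.
apply: (measurability _ (RGenOpens.measurableE R)).
move=> _ [_ [a [b ->] <-]]; rewrite setTI; apply: sub_sigma_algebra.
have /continuousP := @coord_continuous R n 1 i ord0.
by apply; exact: interval_open.
Qed.

Section lebesgue.
Variable R : realType.

Definition consmx n (p : 'cV[R]_n * measurableTypeR R) : 'cV[R]_n.+1 :=
  col_mx (p.2 : R)%:M p.1.

Lemma measurable_consmx n : measurable_fun [set: _] (@consmx n).
Proof.
apply: measurable_fun_cV => i.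
case: (unliftP ord0 i) => [j ->|->].
  rewrite (_ : (fun _ => _) = (fun x : 'cV[R]_n => x j ord0) \o fst); last first.
    apply/funext => p; rewrite /consmx /= (_ : lift ord0 j = rshift 1 j).
      exact: col_mxEd.
    exact/val_inj.
  by apply: measurableT_comp; [exact: measurable_coord_cV|exact: measurable_fst].
rewrite (_ : (fun _ => _) = snd); first exact: measurable_snd.
apply/funext => p; rewrite /consmx /= (_ : ord0 = lshift n (ord0 : 'I_1)).
  by apply: (etrans (col_mxEu _ _ _ _)); rewrite mxE eqxx mulr1n.
exact/val_inj.
Qed.

Section lebesgue_step.
Variables (n : nat) (mu : {measure set 'cV[R]_n -> \bar R}).

Definition lebesgue_step : set 'cV[R]_n.+1 -> \bar R :=
  pushforward (mu \x @lebesgue_measure R)%E (@consmx n).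

HB.instance Definition _ := isMeasurableFun.Build _ _ _ _ (@consmx n)
  (@measurable_consmx n).

Let step0 : lebesgue_step set0 = 0%E.
Proof. by rewrite /lebesgue_step /pushforward preimage_set0 measure0. Qed.

Let step_ge0 B : (0 <= lebesgue_step B)%E.
Proof. exact: measure_ge0. Qed.

Let step_sigma_additive : semi_sigma_additive lebesgue_step.
Proof.
by apply: measure_semi_sigma_additive; exact: measurable_consmx.
Qed.

HB.instance Definition _ := isMeasure.Build _ _ _ lebesgue_step
  step0 step_ge0 step_sigma_additive.

End lebesgue_step.

(* Lebesgue measure on R^n, as the n-fold product of the one on R; on R^0 it is
   the unit mass. *)
Fixpoint lebesgue_cV n : {measure set 'cV[R]_n -> \bar R} :=
  match n with
  | 0 => \d_(0 : 'cV[R]_0)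
  | n'.+1 => lebesgue_step (lebesgue_cV n')
  end.

Lemma lebesgue_cV_box n (B : 'I_n -> set (measurableTypeR R)) :
  (forall i, measurable (B i)) ->
  lebesgue_cV n [set x | forall i, B i (x i ord0)] =
  (\prod_(i < n) lebesgue_measure (B i))%E.
Proof.
elim: n B => [|n IH] B mB.
  by rewrite big_ord0 /= diracE mem_set//= => -[].
have mbox : measurable
    [set x : 'cV[R]_n | forall i, B (lift ord0 i) (x i ord0)].
  rewrite (_ : mkset _ = \bigcap_(i in [set: 'I_n])
    ((fun x : 'cV[R]_n => x i ord0) @^-1` B (lift ord0 i))).
    apply: fin_bigcap_measurable => [|i _]; first exact: finite_finset.
    by rewrite -[X in measurable X]setTI; apply: measurable_coord_cV => //; exact: mB.
  by apply/seteqP; split => [x hx i _|x hx i]; [exact: (hx i)|exact: (hx i I)].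
rewrite big_ord_recl muleC -IH// -product_measure1E//.
rewrite /= /lebesgue_step /pushforward; congr (_ _).
have c0 p : @consmx n p ord0 ord0 = p.2.
  rewrite /consmx (_ : ord0 = lshift n (ord0 : 'I_1)); last exact/val_inj.
  by apply: (etrans (col_mxEu _ _ _ _)); rewrite mxE eqxx mulr1n.
have cS p (j : 'I_n) : @consmx n p (lift ord0 j) ord0 = p.1 j ord0.
  rewrite /consmx (_ : lift ord0 j = rshift 1 j); last exact/val_inj.
  exact: col_mxEd.
apply/seteqP; split => p /= hp.
  split => [i /=|]; first by rewrite -cS; exact: hp.
  by rewrite -c0; exact: hp.
move=> i; case: (unliftP ord0 i) => [j ->|->]; last by rewrite c0; exact: hp.2.
by rewrite cS; exact: hp.1.
Qed.

End lebesgue.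

Definition continuous_distribution (R : realType) n (P : probability 'cV[R]_n R) :=
  exists f : 'cV[R]_n -> R,
    [/\ measurable_fun [set: 'cV[R]_n] f,
        forall x, 0 <= f x &
        forall B, measurable B ->
          P B = (\int[lebesgue_cV R n]_(x in B) (f x)%:E)%E].

Definition expmx (R : realType) n (A : 'M[R]_n) : 'M[R]_n :=
  limn (series (fun k => (k`!%:R)^-1 *: A ^+ k)).

Definition inner (R : realType) n (u v : 'cV[R]_n) : R :=
  \sum_(i < n) u i ord0 * v i ord0.

Definition kernel_of (R : realType) m n (M : 'M[R]_(m, n)) : set 'cV[R]_n :=
  [set x | M *m x = 0].

Definition orthogonal_compl (R : realType) n (S : set 'cV[R]_n) :
    set 'cV[R]_n :=
  [set v | forall x, S x -> inner v x = 0].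

Lemma orthogonal_compl_kernel (R : realType) m n (M : 'M[R]_(m, n)) :
  orthogonal_compl (kernel_of M) = range (fun w : 'cV[R]_m => M^T *m w).
Proof.
have innerE (u v : 'cV[R]_n) : inner u v = (u^T *m v) ord0 ord0.
  by rewrite mxE; apply: eq_bigr => i _; rewrite mxE.
apply/seteqP; split => [v /= hv|_ [w _ <-] x /= Mx0]; last first.
  by rewrite innerE trmx_mul trmxK -mulmxA Mx0 mulmx0 mxE.
have /submxP[w vE] : (v^T <= M)%MS.
  rewrite submxE; apply/eqP/matrixP => i j; rewrite (ord1 i).
  have /hv : kernel_of M (col j (cokermx M)).
    by rewrite /kernel_of/= colE mulmxA mulmx_coker mul0mx.
  by rewrite innerE !mxE => hv0; rewrite -[RHS]hv0; apply: eq_bigr => k _; rewrite !mxE.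
by exists w^T => //; rewrite -trmx_mul -vE trmxK.
Qed.

Definition observable_directions (R : realType) m n
    (A : 'M[R]_n) (C : 'M[R]_(m, n)) : set 'cV[R]_n :=
  \bigcup_(t in [set t : R | 0 <= t])
    orthogonal_compl (kernel_of (C *m expmx (t *: A))).

Definition algebraic_variety (R : realType) n (V : set 'cV[R]_n) :=
  exists p : mpoly.mpoly n R,
    V = [set x | mpoly.meval (fun i => x i ord0) p = 0].

Definition output_distribution (R : realType) m n
    (A : 'M[R]_n) (C : 'M[R]_(m, n)) (P : probability 'cV[R]_n R) (t : R) :
    set 'cV[R]_m -> \bar R :=
  pushforward P (fun x => C *m expmx (t *: A) *m x).

(* Two measures are equal when they agree on the Borel sets: their values on
   non-measurable sets are not meaningful. *)
Definition ensemble_observable (R : realType) m n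
    (A : 'M[R]_n) (C : 'M[R]_(m, n)) (K : set (probability 'cV[R]_n R)) :=
  forall P1 P2 : probability 'cV[R]_n R,
    K P1 -> K P2 ->
    continuous_distribution P1 -> continuous_distribution P2 ->
    (forall t : R, 0 <= t -> forall B : set 'cV[R]_m, measurable B ->
       output_distribution A C P1 t B = output_distribution A C P2 t B) ->
    forall B : set 'cV[R]_n, measurable B -> P1 B = P2 B.

(* R[i] seen as a numFieldType, so that it carries the topology of its norm. *)
Definition Cplx (R : realType) : numFieldType := R[i].

Definition Cexpectation (R : realType) d (T : measurableType d)
    (P : probability T R) (Z : T -> Cplx R) : Cplx R :=
  (\int[P]_x complex.Re (Z x)) +i* (\int[P]_x complex.Im (Z x)).

Definition expi (R : realType) (a : R) : Cplx R := cos a +i* sin a.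

Definition charfun (R : realType) n (P : probability 'cV[R]_n R)
    (xi : 'cV[R]_n) : Cplx R :=
  Cexpectation P (fun x => expi (inner xi x)).

Definition real_analytic (R : realType) (f : R -> Cplx R) :=
  forall x0 : R, exists a : nat -> Cplx R, exists2 r : R, 0 < r &
    forall x : R, `|x - x0| < r ->
      series (fun k => a k * ((x - x0)%:C : Cplx R) ^+ k) @ \oo --> f x.

(* Main.v *)
Require Import Defs.
From HB Require Import structures.
From mathcomp Require Import all_boot all_order all_algebra.
From mathcomp Require Import all_classical all_reals all_analysis.
From mathcomp Require Import measurable_realfun complex ring lra.
From mathcomp Require mpoly.

Set Implicit Arguments.
Unset Strict Implicit.
Unset Printing Implicit Defensive.

Import Order.TTheory GRing.Theory Num.Theory.
Import numFieldNormedType.Exports.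

Local Open Scope classical_set_scope.
Local Open Scope ring_scope.

(** The output at time [t] determines the law of [<v, X>] for every [v] in the
    image of the transpose of [C e^(tA)].  So if two initial distributions give
    the same outputs, the moments [E <v, X>^N] agree for every [v] in the set
    of observable directions.  Each difference of moments is a polynomial in
    [v] ([moment_polynomial]); its zero set is a variety that contains the
    observable directions, hence it is the whole space, and all directional
    moments of the two distributions agree ([equal_moment_variety]).

    Analyticity is used twice.  At the origin, it makes all moments finite
    ([even_moment_integrable]): the [2k]-th symmetric difference of
    [s |-> E cos (s X)] with step [s] at [0] is, up to sign,
    [E (2 - 2 cos (s X))^k]; it is [O(s^(2k))] because the function has a power
    series, and Fatou's lemma bounds [E X^(2k)] after division by [s^(2k)].
    On the whole line, it gives back the characteristic function from the
    moments ([eq_integral_analytic]): the difference of the two functions on a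
    line is [O(s^N)] at [0] for every [N], by the Taylor formula for [cos] and
    [sin] under the expectation, and an analytic function on the real line that
    is flat at a point vanishes ([analytic_flat]).

    So the two characteristic functions agree, and then so do the distributions
    ([charfun_uniqueness]).  The functions with the same expectation under both
    are closed under linear combinations and bounded pointwise limits; starting
    from the trigonometric functions, these operations produce an algebra
    that contains the indicators of half-spaces, hence those of all Borel
    sets. *)

(** * Limits of real sequences *)

Section real_sequences.
Variable R : realType.
Implicit Types (u v : nat -> R) (l B : R).

Lemma cvg_dist_le u v l : (forall n, `|u n - l| <= v n) ->
  v @ \oo --> 0 -> u @ \oo --> l.
Proof.
move=> uv v0; apply/subr_cvg0/norm_cvg0P.
apply: (squeeze_cvgr _ (cvg_cst 0) v0).
by apply: nearW => n; rewrite normr_ge0 uv.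
Qed.

Lemma norm_lim_le u l B : (forall k, `|u k| <= B) -> u @ \oo --> l ->
  `|l| <= B.
Proof.
move=> uB ul; have cu : (fun k => `|u k|) @ \oo --> `|l| by exact: cvg_norm.
rewrite -(cvg_lim _ cu)//.
by apply: limr_le; [exact: cvgP cu|exact: nearW].
Qed.

End real_sequences.

(** * Real power series and analytic functions *)

Section power_series.
Variable R : realType.
Implicit Types (a : nat -> R) (f g : R -> R) (r h x y : R).

(** The variable is the displacement [h] from the centre of the series, so that
    an expansion of [f] around [x] is one of [fun h => f (x + h)]. *)
Definition expands a r f :=
  forall h, `|h| < r -> series (fun k => a k * h ^+ k) @ \oo --> f h.

Lemma sum_half_geometric_le q N n : 0 <= q -> q <= 2^-1 ->
  \sum_(N <= k < n) q ^+ k <= 2 * q ^+ N :> R.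
Proof.
move=> q0 q1; have [Nn|nN] := leqP N n; last first.
  by rewrite big_geq ?mulr_ge0 ?exprn_ge0// ltnW.
rewrite -(subnKC Nn); move: (n - N)%N => m.
(* With twice the next term added on the left, the bound becomes inductive. *)
suff : \sum_(N <= k < N + m) q ^+ k + 2 * q ^+ (N + m) <= 2 * q ^+ N.
  by apply: le_trans; rewrite lerDl mulr_ge0 ?exprn_ge0.
elim: m => [|p IHp]; first by rewrite addn0 big_geq// add0r.
apply: le_trans IHp; rewrite addnS big_nat_recr ?leq_addr//= exprS.
by have := exprn_ge0 (N + p) q0; nra.
Qed.

(** The terms are bounded at [h0 = r / 2] because the series converges there, so
    for [`|h| <= h0 / 2] the tail from rank [N] on is dominated by a geometric
    series of ratio at most [1 / 2]. *)
Lemma expands_remainder a r f N : 0 < r -> expands a r f ->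
  exists2 d, 0 < d & exists2 K, 0 <= K & forall h, `|h| <= d ->
    `|f h - \sum_(0 <= k < N) a k * h ^+ k| <= K * `|h| ^+ N.
Proof.
move=> r0 af; pose h0 := r / 2.
have h0_gt0 : 0 < h0 by rewrite divr_gt0.
have h0r : `|h0| < r by rewrite gtr0_norm// /h0; lra.
have /cvgP/cvg_series_cvg_0 := af _ h0r.
move=> /cvgP/cvg_seq_bounded[M [Mr HM]].
pose B := Num.max 0 (M + 1).
have B0 : 0 <= B by rewrite le_max lexx.
have HB k : `|a k| * h0 ^+ k <= B.
  rewrite -(gtr0_norm (exprn_gt0 k h0_gt0)) -normrM le_max; apply/orP; right.
  by apply: HM => //; rewrite ltrDl.
exists (h0 / 2); first by rewrite divr_gt0.
exists (B * 2 / h0 ^+ N); first by rewrite divr_ge0 ?mulr_ge0 ?exprn_ge0// ltW.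
move=> h hd; have hr : `|h| < r by apply: le_lt_trans hd _; rewrite /h0; lra.
pose q := `|h| / h0.
have q0 : 0 <= q by rewrite divr_ge0// ltW.
have q1 : q <= 2^-1 by rewrite ler_pdivrMr// mulrC.
have cv := af _ hr.
set S := \sum_(0 <= k < N) _.
have cvS : (fun n => `|series (fun k => a k * h ^+ k) n - S|) @ \oo --> `|f h - S|.
  by apply: cvg_norm; apply: cvgB => //; exact: cvg_cst.
rewrite -(cvg_lim _ cvS)//; apply: limr_le; first exact: cvgP cvS.
exists N => // n /= Nn.
rewrite /series/= (big_cat_nat (leq0n N) Nn)//= addrAC subrr add0r.
apply: le_trans (ler_norm_sum _ _ _) _.
apply: (@le_trans _ _ (\sum_(N <= k < n) B * q ^+ k)).
  apply: ler_sum => k _; rewrite normrM normrX /q expr_div_n mulrA.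
  rewrite ler_pdivlMr ?exprn_gt0// mulrAC ler_wpM2r// exprn_ge0//.
rewrite -mulr_sumr -mulrA -mulrA ler_wpM2l//.
apply: le_trans (sum_half_geometric_le _ _ q0 q1) _.
by rewrite /q expr_div_n mulrA mulrAC.
Qed.

(** The hypothesis asks for the bound only at points [h <> 0] arbitrarily close to
    [0], so that it covers both a function that is [O(h^N)] for all [N] and one
    whose zeros accumulate at the centre.  The first nonzero coefficient [a k]
    would force [`|f h|] to be at least of order [`|h| ^+ k], against the bound
    for [N = k + 1]. *)
Lemma expands_flat a r f : 0 < r -> expands a r f ->
  (forall N, exists K, forall d, 0 < d ->
     exists h, [/\ 0 < `|h|, `|h| < d & `|f h| <= K * `|h| ^+ N]) ->
  forall k, a k = 0.
Proof.
move=> r0 af flat k; have [N] := ubnP k; elim: N k => // N IH k.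
rewrite ltnS => kN.
have [d d0 [K K0 HK]] := expands_remainder k.+1 r0 af.
have [K1 HK1] := flat k.+1.
apply/eqP; rewrite -normr_eq0 eq_le normr_ge0 andbT leNgt; apply/negP => ak0.
pose e := `|a k| / (`|K1| + K + 1).
have e0 : 0 < e by rewrite divr_gt0// ltr_pwDr ?addr_ge0.
have [h [h0 hd fh]] := HK1 (Num.min d e) ltac:(by rewrite lt_min d0).
move: hd; rewrite lt_min => /andP[hd he].
have := HK h (ltW hd); rewrite big_nat_recr//= big_nat big1 ?add0r; last first.
  by move=> j /andP[_ jk]; rewrite IH ?mul0r// (leq_trans jk).
move=> rem.
have : `|a k| * `|h| ^+ k <= (`|K1| + K) * `|h| ^+ k.+1.
  rewrite -normrX -normrM mulrDl.
  rewrite (_ : a k * h ^+ k = f h - (f h - a k * h ^+ k)); last by ring.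
  apply: le_trans (ler_normB _ _) _; apply: lerD => //.
  by apply: le_trans fh _; rewrite ler_wpM2r ?exprn_ge0// ler_norm.
rewrite exprS mulrA ler_pM2r ?exprn_gt0// => H.
move: he; rewrite /e ltr_pdivlMr; last by rewrite ltr_pwDr ?addr_ge0.
by apply/negP; rewrite -leNgt; apply: le_trans H _; rewrite mulrC ler_wpM2l// lerDl.
Qed.

Lemma expands0 r f : expands (fun=> 0) r f -> forall h, `|h| < r -> f h = 0.
Proof.
move=> H h /H; rewrite (_ : series _ = fun=> 0).
  by move=> /cvg_lim <- //; exact: lim_cst.
by apply/funext => n; rewrite /series/= big1// => i _; rewrite mul0r.
Qed.

Definition analytic f :=
  forall x, exists a, exists2 r, 0 < r & expands a r (fun h => f (x + h)).

Lemma analyticB f g : analytic f -> analytic g -> analytic (fun x => f x - g x).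
Proof.
move=> af ag x; have [a [r r0 ar]] := af x; have [b [s s0 bs]] := ag x.
exists (fun k => a k - b k); exists (Num.min r s); first by rewrite lt_min r0.
move=> h; rewrite lt_min => /andP[hr hs].
rewrite (_ : series _ = series (fun k => a k * h ^+ k) \- series (fun k => b k * h ^+ k)).
  by apply: cvgB; [exact: ar|exact: bs].
apply/funext => n; rewrite /series/= -sumrB; apply: eq_bigr => i _; ring.
Qed.

(** The interior of the zero set contains [0] by flatness.  It is also closed: at a
    limit point the zeros accumulate, so all coefficients of the expansion there
    vanish by [expands_flat].  The real line is connected. *)
Lemma analytic_flat f : analytic f ->
  (forall N, exists K, forall x, `|f x| <= K * `|x| ^+ N) -> f = fun=> 0.
Proof.
move=> af flat; pose Z := (f @^-1` [set 0])°.
(* Flatness at [x], in the form of [expands_flat], puts [x] in [Z]. *)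
have acc x a r : 0 < r -> expands a r (fun h => f (x + h)) ->
    (forall N, exists K, forall d, 0 < d ->
     exists h, [/\ 0 < `|h|, `|h| < d & `|f (x + h)| <= K * `|h| ^+ N]) -> Z x.
  move=> r0 ax /(expands_flat r0 ax) a0.
  have H : expands (fun=> 0) r (fun h => f (x + h)) by rewrite -(funext a0).
  rewrite /Z /interior/=; apply/nbhs_ballP; exists r => //= y.
  rewrite /ball/= distrC => xy.
  by have := expands0 H xy; rewrite addrC subrK.
have Z0 : Z 0.
  have [a [r r0 ar]] := af 0; apply: (acc _ _ _ r0 ar) => N.
  have [K HK] := flat N; exists K => d d0; exists (d / 2).
  have d20 : 0 < d / 2 by rewrite divr_gt0.
  rewrite gtr0_norm//; split => //; first by lra.
  by have := HK (d / 2); rewrite add0r [`|d / 2|]gtr0_norm.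
have cZ : closed Z.
  move=> x clx; have [a [r r0 ar]] := af x; apply: (acc _ _ _ r0 ar) => N.
  exists 0 => d d0.
  have [z [Zz xz]] := clx _ (nbhsx_ballx x d d0).
  have /nbhs_ballP[e /= e0 ez] : nbhs z (f @^-1` [set 0] `&` ball x d).
    apply: filterI => //; apply: open_nbhs_nbhs; split => //; exact: ball_open.
  (* The zero must differ from [x]: when [z] is [x], take a neighbour of it. *)
  have [y [yx yz]] : exists y, y != x /\ ball z e y.
    have [zx|zx] := eqVneq z x; last by exists z; split=> //; exact: ballxx.
    exists (z + e / 2); split.
      by rewrite -subr_eq0 zx addrAC subrr add0r gt_eqF// divr_gt0.
    by rewrite /ball/= opprD addNKr normrN gtr0_norm ?divr_gt0//; lra.
  have [fy xy] := ez _ yz; exists (y - x); split.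
  - by rewrite normr_gt0 subr_eq0.
  - by move: xy; rewrite /ball/= distrC.
  - by rewrite addrC subrK fy normr0 mul0r.
have ZT : Z = setT.
  have /(_ Z) : connected [set: R] by apply/connected_intervalP => ? ? ? ? ? ?.
  apply; first by exists 0.
  - by exists Z; [exact: open_interior|rewrite setTI].
  - by exists Z => //; rewrite setTI.
apply/funext => x; have : Z x by rewrite ZT.
by move=> /nbhs_singleton.
Qed.

(** Boundedness makes the Taylor estimate global: far from [0], the function and
    every monomial of degree less than [N] are [O(`|y| ^+ N)]. *)
Lemma bounded_expands_remainder a f N :
  (forall r, expands a r f) -> (forall x, `|f x| <= 1) ->
  exists K, forall y,
    `|f y - \sum_(0 <= k < N) a k * y ^+ k| <= K * `|y| ^+ N.
Proof.
move=> af f1; have [d d0 [K K0 HK]] := expands_remainder N ltr01 (af 1).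
pose S := \sum_(0 <= k < N) `|a k| * d ^+ k.
have S0 : 0 <= S by apply: sumr_ge0 => k _; rewrite mulr_ge0 ?exprn_ge0// ltW.
exists (K + (1 + S) / d ^+ N) => y; have [yd|/ltW dy] := leP `|y| d.
  apply: le_trans (HK _ yd) _; rewrite ler_wpM2r ?exprn_ge0// lerDl divr_ge0 ?addr_ge0//.
  by rewrite exprn_ge0// ltW.
pose q := `|y| / d; have q1 : 1 <= q by rewrite ler_pdivlMr// mul1r.
have yE : `|y| = d * q by rewrite mulrCA divff ?mulr1// gt_eqF.
apply: (@le_trans _ _ ((1 + S) * q ^+ N)); last first.
  rewrite [leRHS]mulrDl -[X in _ <= _ + X]mulrA [X in _ <= _ + _ * X]mulrC.
  rewrite -expr_div_n lerDr.
  by rewrite mulr_ge0 ?exprn_ge0.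
apply: le_trans (ler_normB _ _) _; rewrite mulrDl mul1r; apply: lerD.
  by apply: le_trans (f1 y) _; rewrite exprn_ege1.
apply: le_trans (ler_norm_sum _ _ _) _; rewrite /S mulr_suml !big_nat.
apply: ler_sum => k /andP[_ kN]; rewrite normrM normrX yE exprMn mulrA.
by rewrite ler_wpM2l ?mulr_ge0 ?exprn_ge0 ?(ltW d0)// ler_weXn2l// ltnW.
Qed.

End power_series.
(** * Taylor remainders and iterated second differences *)

Section cos_sin.
Variable R : realType.
Implicit Types (x y u v : R) (f g : R -> R) (p : {poly R}).

Definition cos_taylor (k : nat) : R := (~~ odd k)%:R * (-1) ^+ k./2 * (k`!%:R)^-1.

Definition sin_taylor (k : nat) : R := (odd k)%:R * (-1) ^+ k.-1./2 * (k`!%:R)^-1.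

Lemma expands_cos r : expands cos_taylor r (@cos R).
Proof.
by move=> x _; rewrite unlock -cos_coeffE; exact: is_cvg_series_cos_coeff.
Qed.

Lemma expands_sin r : expands sin_taylor r (@sin R).
Proof.
by move=> x _; rewrite unlock -sin_coeffE; exact: is_cvg_series_sin_coeff.
Qed.

(** The opposite of the usual second difference: this sign gives the nonnegative
    factor [2 - 2 * cos s] on [u |-> cos (s * u)]. *)
Definition second_diff f u := 2 * f u - f (u + 1) - f (u - 1).

Lemma iter_second_diffD k f g :
  iter k second_diff (fun u => f u + g u) =
  (fun u => iter k second_diff f u + iter k second_diff g u).
Proof.
elim: k => //= k ->; apply/funext => u; rewrite /second_diff; ring.
Qed.

Lemma iter_second_diff_le k f B u :
  (forall v, `|v - u| <= k%:R -> `|f v| <= B) ->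
  `|iter k second_diff f u| <= 4 ^+ k * B.
Proof.
elim: k u => [|k IH] u fB /=.
  by rewrite expr0 mul1r fB// subrr normr0.
have near w : `|w - u| <= 1 -> `|iter k second_diff f w| <= 4 ^+ k * B.
  move=> wu; apply: IH => v vw; apply: fB.
  rewrite (_ : v - u = (v - w) + (w - u)); last by ring.
  by apply: le_trans (ler_normD _ _) _; rewrite -[k.+1]addn1 natrD lerD.
rewrite /second_diff; set F := iter k _ f in near *.
have /ler_normlP[H1 H2] := near u ltac:(by rewrite subrr normr0).
have /ler_normlP[H3 H4] := near (u + 1) ltac:(by rewrite addrAC subrr add0r normr1).
have /ler_normlP[H5 H6] := near (u - 1) ltac:(by rewrite addrAC subrr add0r normrN normr1).
by apply/ler_normlP; split; rewrite exprS; lra.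
Qed.

Let shift_diff p := p \Po ('X + 1%:P) - p.

Let size_shift_diff p : (size (shift_diff p) <= (size p).-1)%N.
Proof.
have [->|p0] := eqVneq p 0; first by rewrite /shift_diff comp_poly0 subr0 size_poly0.
have sX : size ('X + 1%:P : {poly R}) = 2%N by rewrite size_XaddC.
apply/leq_sizeP => j; rewrite leq_eqVlt => /predU1P[<-|].
  rewrite coefB -[in X in X - _](size_comp_poly2 p sX) -!lead_coefE.
  by rewrite lead_coef_comp ?sX// lead_coefXaddC expr1n mulr1 subrr.
rewrite prednK ?lt0n ?size_poly_eq0// => pj.
by rewrite coefB !nth_default ?subr0// size_comp_poly2.
Qed.

(** On polynomials, [second_diff] is, up to sign and a translation, the square of
    the forward difference [shift_diff], and each forward difference removes the
    leading term. *)
Lemma second_diff_poly p :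
  exists2 q : {poly R}, second_diff (horner p) = horner q & (size q <= (size p).-2)%N.
Proof.
exists (- (shift_diff (shift_diff p) \Po ('X - 1%:P))).
  apply/funext => u; rewrite /second_diff /shift_diff !(hornerE, horner_comp).
  rewrite subrK; ring.
rewrite size_polyN size_comp_poly2 ?size_XsubC//.
by apply: leq_trans (size_shift_diff _) _; rewrite -!subn1 leq_sub2r// subn1.
Qed.

Lemma iter_second_diff_poly k p : (size p <= k.*2)%N ->
  iter k second_diff (horner p) = fun=> 0.
Proof.
elim: k p => [|k IH] p sp.
  rewrite leqn0 size_poly_eq0 in sp; rewrite (eqP sp); apply/funext => u /=.
  by rewrite horner0.
rewrite iterSr; have [q -> sq] := second_diff_poly p; apply: IH.
by apply: leq_trans sq _; rewrite -subn2 leq_subLR add2n -doubleS.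
Qed.

(** The Taylor polynomial of degree less than [2k] is killed, and what remains is
    [O(s ^+ k.*2)] at the points [s * u] with [`|u| <= k], the only ones that the
    iterated difference at [0] uses. *)
Lemma iter_second_diff_expands a r f k : 0 < r -> expands a r f ->
  exists2 d, 0 < d & exists K, forall s, 0 < s -> s <= d ->
    `|iter k second_diff (fun u => f (s * u)) 0| <= K * s ^+ k.*2.
Proof.
move=> r0 af; have [d d0 [K K0 HK]] := expands_remainder k.*2 r0 af.
(* [k.+1] rather than [k], because [k] may be [0]. *)
exists (d / k.+1%:R); first by rewrite divr_gt0.
exists (4 ^+ k * (K * k.+1%:R ^+ k.*2)) => s s0 sd.
pose p := \poly_(i < k.*2) (a i * s ^+ i).
have pE u : p.[u] = \sum_(0 <= i < k.*2) a i * (s * u) ^+ i.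
  rewrite horner_poly big_mkord; apply: eq_bigr => i _.
  by rewrite exprMn mulrA.
rewrite (_ : (fun u => f (s * u)) = fun u => p.[u] + (f (s * u) - p.[u])); last first.
  by apply/funext => u; rewrite addrC subrK.
rewrite iter_second_diffD iter_second_diff_poly ?size_poly// add0r -mulrA.
apply: iter_second_diff_le => v; rewrite subr0 => vk; rewrite pE.
have vk1 : `|v| <= k.+1%:R by apply: le_trans vk _; rewrite ler_nat.
have sv : `|s * v| <= s * k.+1%:R by rewrite normrM gtr0_norm// ler_pM2l.
apply: le_trans (HK _ _) _.
  by apply: le_trans sv _; rewrite -ler_pdivlMr.
rewrite -mulrA -exprMn [k.+1%:R * s]mulrC ler_wpM2l//.
by rewrite lerXn2r ?nnegrE// mulr_ge0// ltW.
Qed.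

End cos_sin.
(** * Finiteness of moments *)

Section moments.
Context d (T : measurableType d) (R : realType) (P : probability T R).
Implicit Types (X f g : T -> R).

Lemma bounded_integrable f B : measurable_fun [set: T] f ->
  (forall x, `|f x| <= B) -> P.-integrable [set: T] (EFin \o f).
Proof.
move=> mf fB; apply: (@le_integrable _ _ _ _ _ _ _ (EFin \o cst B)) => //.
- exact/measurable_EFinP.
- by move=> x _ /=; rewrite lee_fin (le_trans (fB x))// ler_norm.
- exact: finite_measure_integrable_cst.
Qed.

Lemma integrable_le_norm f g : measurable_fun [set: T] f ->
  (forall x, `|f x| <= g x) -> P.-integrable [set: T] (EFin \o g) ->
  P.-integrable [set: T] (EFin \o f).
Proof.
move=> mf fg; apply: le_integrable => //; first exact/measurable_EFinP.
by move=> x _ /=; rewrite lee_fin (le_trans (fg x))// ler_norm.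
Qed.

Lemma measurable_cos_comp X : measurable_fun [set: T] X ->
  measurable_fun [set: T] (fun x => cos (X x)).
Proof.
by apply: measurableT_comp; apply: continuous_measurable_fun; exact: continuous_cos.
Qed.

Lemma measurable_sin_comp X : measurable_fun [set: T] X ->
  measurable_fun [set: T] (fun x => sin (X x)).
Proof.
by apply: measurableT_comp; apply: continuous_measurable_fun; exact: continuous_sin.
Qed.

(** Fatou's lemma, in the form that makes a limit integrable when the integrals of
    its approximations are bounded. *)
Lemma integrable_of_fatou (f_ : nat -> T -> R) f B :
  (forall n, measurable_fun [set: T] (f_ n)) -> measurable_fun [set: T] f ->
  (forall n x, 0 <= f_ n x) ->
  (forall n, P.-integrable [set: T] (EFin \o f_ n)) ->
  (forall n, \int[P]_x f_ n x <= B) ->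
  (forall x, f_ ^~ x @ \oo --> f x) ->
  P.-integrable [set: T] (EFin \o f).
Proof.
move=> mf_ mf f0 intf fB ff; apply/integrableP; split; first exact/measurable_EFinP.
have fge0 x : 0 <= f x.
  by rewrite -(cvg_lim _ (ff x))//; apply: limr_ge; [exact: cvgP (ff x)|exact: nearW].
rewrite (_ : (fun x => _) = fun x => limn_einf (fun n => (f_ n x)%:E)); last first.
  apply/funext => x /=; rewrite ger0_norm//.
  have /cvg_limn_einf_sup[-> _//] : (f_ n x)%:E @[n --> \oo] --> (f x)%:E.
  by apply: cvg_EFin; [exact: nearW|exact: ff].
have mEf n : measurable_fun [set: T] (EFin \o f_ n) by exact/measurable_EFinP.
have Ef0 n x : [set: T] x -> (0 <= (EFin \o f_ n) x)%E by rewrite lee_fin.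
apply: le_lt_trans (fatou P measurableT mEf Ef0) _.
apply: (@le_lt_trans _ _ B%:E); last exact: ltry.
rewrite limn_einf_lim; apply: lime_le; first exact: is_cvg_einfs.
apply: nearW => n; apply: (@le_trans _ _ (\int[P]_x (f_ n x)%:E)%E).
  apply: ereal_inf_lbound; exists n => //=.
by rewrite -[leLHS]fineK ?lee_fin//; [exact: fB|exact: (integrable_fin_num _ (intf n))].
Qed.

Lemma Rintegral_probability_cst (c : R) : \int[P]_x c = c.
Proof. by rewrite Rintegral_cst//= (@probability_setT _ _ _ P) mulr1. Qed.

Lemma cvg_bounded_Rintegral (f_ : nat -> T -> R) f B :
  (forall k, measurable_fun [set: T] (f_ k)) ->
  (forall k x, `|f_ k x| <= B) -> (forall x, f_ ^~ x @ \oo --> f x) ->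
  (fun k => \int[P]_x f_ k x) @ \oo --> \int[P]_x f x.
Proof.
move=> mf fB ff.
have mf' : measurable_fun [set: T] f.
  by apply: measurable_fun_cvg mf _ => x _; exact: ff.
have intf : P.-integrable [set: T] (EFin \o f).
  by apply: bounded_integrable mf' (_ : forall x, `|f x| <= B) => x;
    apply: norm_lim_le (ff x) => k.
apply: fine_cvg; rewrite fineK; last exact: (integrable_fin_num _ intf).
apply: (@dominated_cvg _ _ _ _ _ _ _ _ (EFin \o cst B)) => //.
- by move=> k; exact/measurable_EFinP.
- by move=> x _; apply: cvg_EFin; [exact: nearW|exact: ff].
- exact: finite_measure_integrable_cst.
- by move=> k x _; rewrite /= lee_fin.
Qed.

Let charfun_cos X (s : R) := \int[P]_x cos (s * X x).

Lemma integrable_cos_weight X k s t : measurable_fun [set: T] X ->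
  P.-integrable [set: T]
    (EFin \o (fun x => (2 - 2 * cos (s * X x)) ^+ k * cos (t * X x))).
Proof.
move=> mX; have mcos v : measurable_fun [set: T] (fun x => cos (v * X x)).
  by apply: measurable_cos_comp; exact: measurable_funM.
apply: (@bounded_integrable _ (4 ^+ k)).
  by apply: measurable_funM => //; apply: measurable_funX;
    apply: measurable_funB => //; exact: measurable_funM.
move=> x; rewrite normrM normrX -[leRHS]mulr1.
rewrite ler_pM ?exprn_ge0// ?cos_max// lerXn2r ?nnegrE//.
by have := cos_max (s * X x); rewrite !ler_norml; lra.
Qed.

(** Each step multiplies the integrand by [2 - 2 * cos (s * X x)], as
    [cos (a + b) + cos (a - b) = 2 * cos a * cos b]. *)
Lemma iter_second_diff_charfun X k s u : measurable_fun [set: T] X ->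
  iter k (@second_diff R) (fun u => charfun_cos X (s * u)) u =
  \int[P]_x ((2 - 2 * cos (s * X x)) ^+ k * cos (s * u * X x)).
Proof.
move=> mX; pose w k u x := (2 - 2 * cos (s * X x)) ^+ k * cos (s * u * X x).
have intw j v : P.-integrable [set: T] (EFin \o w j v).
  exact: integrable_cos_weight.
elim: k u => [|k IH] u /=.
  by apply: eq_Rintegral => x _; rewrite expr0 mul1r.
rewrite /second_diff !IH.
have intw2 : P.-integrable [set: T] (EFin \o (fun x => 2 * w k u x)).
  exact: (integrableZl _ 2 (intw k u)).
transitivity (\int[P]_x (2 * w k u x - w k (u + 1) x - w k (u - 1) x)).
  rewrite RintegralB//; last exact: (integrableB _ intw2 (intw k (u + 1))).
  by rewrite RintegralB// RintegralZl.
apply: eq_Rintegral => x _; rewrite /w exprS.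
rewrite mulrDr mulrBr !mulr1 !mulrDl mulNr cosD cosB; ring.
Qed.

(** Along [s n -> 0], the variables [((2 - 2 * cos (s n * X)) / s n ^+ 2) ^+ k]
    converge to [X ^+ k.*2], and their expectations are bounded since the
    iterated second difference of the analytic function [E cos (s X)] at [0] is
    [O(s ^+ k.*2)]. *)
Lemma even_moment_integrable X a r k : measurable_fun [set: T] X ->
  0 < r -> expands a r (charfun_cos X) ->
  P.-integrable [set: T] (fun x => (X x ^+ k.*2)%:E).
Proof.
move=> mX r0 /(iter_second_diff_expands k r0)[e e0 [K HK]].
pose s (n : nat) : R := e * harmonic n.
have s0 n : 0 < s n by rewrite mulr_gt0// harmonic_gt0.
have se n : s n <= e.
  by rewrite ger_pMr// /harmonic/= invf_le1// ler1n.
have cvgs : s @ \oo --> 0.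
  by rewrite -[X in _ --> X](mulr0 e); apply: cvgM; [exact: cvg_cst|exact: cvg_harmonic].
pose f n x := ((2 - 2 * cos (s n * X x)) / s n ^+ 2) ^+ k.
have mcos n : measurable_fun [set: T] (fun x => 2 - 2 * cos (s n * X x)).
  apply: measurable_funB => //; apply: measurable_funM => //.
  by apply: measurable_cos_comp; exact: measurable_funM.
have mf n : measurable_fun [set: T] (f n).
  by apply: measurable_funX; exact: measurable_funM.
have f0 n x : 0 <= f n x.
  by apply: exprn_ge0; rewrite divr_ge0 ?exprn_ge0 ?(ltW (s0 n)).
apply: (@integrable_of_fatou f _ K) => //.
- exact: measurable_funX.
- move=> n; apply: (@bounded_integrable _ ((4 / s n ^+ 2) ^+ k)) => // x.
  rewrite ger0_norm// lerXn2r ?nnegrE ?divr_ge0 ?exprn_ge0 ?(ltW (s0 n))//.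
  rewrite ler_pM2r ?invr_gt0 ?exprn_gt0//.
  by have := cos_max (s n * X x); rewrite ler_norml; lra.
- move=> n; have := HK _ (s0 n) (se n).
  rewrite iter_second_diff_charfun// => /(le_trans (ler_norm _)).
  rewrite -ler_pdivrMr ?exprn_gt0//; apply: le_trans.
  rewrite mulrC -RintegralZl//; last exact: integrable_cos_weight.
  rewrite le_eqVlt; apply/orP; left; apply/eqP; apply: eq_Rintegral => x _.
  rewrite /f expr_div_n -exprM mul2n mulr0 mul0r cos0 mulr1 mulrC//.
- move=> x; rewrite -mul2n exprM.
  apply: (@continuous_cvg _ _ _ _ _ _ (fun y : R => y ^+ k)).
    exact: exprn_continuous.
  (* [2 - 2 * cos y] is [y ^+ 2] up to [O(`|y| ^+ 3)]. *)
  have [C HC] := bounded_expands_remainder 3 (@expands_cos R) (@cos_max R).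
  apply: (@cvg_dist_le _ _ (fun n => 2 * C * `|X x| ^+ 3 * s n)); last first.
    rewrite -[X in _ --> X](mulr0 (2 * C * `|X x| ^+ 3)).
    by apply: cvgM => //; exact: cvg_cst.
  move=> n; have := HC (s n * X x); rewrite !big_nat_recr ?big_geq//= /cos_taylor/=.
  rewrite normrM exprMn (gtr0_norm (s0 n)) => H.
  have sn0 := s0 n; have sn00 : s n != 0 by rewrite gt_eqF.
  rewrite (_ : _ / _ - _ = - 2 / s n ^+ 2 * (cos (s n * X x) - (1 - (s n * X x) ^+ 2 / 2)));
    last by field.
  have c0 : 0 <= 2 / s n ^+ 2 by rewrite divr_ge0 ?exprn_ge0 ?(ltW sn0).
  rewrite normrM mulNr normrN (ger0_norm c0).
  move: H; set W := (X in `|_ - X|).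
  rewrite (_ : W = 1 - (s n * X x) ^+ 2 / 2); last first.
    by rewrite /W [0`!](_ : _ = 1%N)// [1`!](_ : _ = 1%N)// [2`!](_ : _ = 2%N)//; field.
  move=> H; rewrite mulrAC ler_pdivrMr ?exprn_gt0//.
  apply: le_trans (ler_wpM2l _ H) _ => //.
  by rewrite le_eqVlt; apply/orP; left; apply/eqP; ring.
Qed.

End moments.
(** * Polynomial approximation of the sign *)

Section sign_approximation.
Variable R : realType.
Implicit Types (s x : R).

(** The iterates of this polynomial converge to the sign on [[-1, 1]].  It is
    odd, so that the limit is right at [0] too. *)
Definition sign_step s : R := (3 * s - s ^+ 3) / 2.

Lemma sign_step_le1 s : `|s| <= 1 -> `|sign_step s| <= 1.
Proof.
rewrite !ler_norml /sign_step => /andP[s1 s2].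
have p1 : 0 <= (1 - s) ^+ 2 * (2 + s) by rewrite mulr_ge0 ?sqr_ge0//; lra.
have p2 : 0 <= (1 + s) ^+ 2 * (2 - s) by rewrite mulr_ge0 ?sqr_ge0//; lra.
by rewrite ler_pdivlMr// ler_pdivrMr//; apply/andP; split; nra.
Qed.

Lemma iter_sign_step_le1 k s : `|s| <= 1 -> `|iter k sign_step s| <= 1.
Proof. by move=> s1; elim: k => //= k /sign_step_le1. Qed.

(** The distance to [1] satisfies
    [1 - sign_step t = (1 - t) * ((1 - t) * (2 + t) / 2)], and the last factor is
    at most [1 - t / 2 <= 1 - s / 2] as long as the iterate [t] is at least [s]. *)
Lemma cvg_iter_sign_step_gt0 s : 0 < s -> s <= 1 ->
  iter n sign_step s @[n --> \oo] --> (1 : R).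
Proof.
move=> s0 s1.
have H n : s <= iter n sign_step s <= 1 /\ 1 - iter n sign_step s <= (1 - s / 2) ^+ n.
  elim: n => [|n [/andP[st t1] IH]] /=.
    by split; [rewrite lexx|rewrite expr0; lra].
  set t := iter n sign_step s in st t1 IH *.
  have tE : 1 - sign_step t = (1 - t) * ((1 - t) * (2 + t) / 2).
    by rewrite /sign_step; field.
  have t0 : 0 < t by lra.
  have ft : (1 - t) * (2 + t) / 2 <= 1 - s / 2 by rewrite ler_pdivrMr//; nra.
  have ft0 : 0 <= (1 - t) * (2 + t) / 2 by rewrite divr_ge0// mulr_ge0; lra.
  split; last first.
    rewrite tE exprSr ler_pM//; lra.
  have : t <= sign_step t by rewrite /sign_step ler_pdivlMr//; nra.
  have : 0 <= 1 - sign_step t by rewrite tE mulr_ge0//; lra.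
  by move=> ? ?; apply/andP; split; lra.
apply: (@cvg_dist_le _ _ (geometric 1 (1 - s / 2))) => [n|].
  have [/andP[_ t1] IH] := H n; rewrite distrC ger0_norm ?subr_ge0//.
  by rewrite /geometric/= mul1r.
by apply: cvg_geometric; rewrite ger0_norm; lra.
Qed.

Lemma cvg_iter_sign_step s : `|s| <= 1 -> iter n sign_step s @[n --> \oo] --> Num.sg s.
Proof.
have odd n x : iter n sign_step (- x) = - iter n sign_step x.
  by elim: n => //= n ->; rewrite /sign_step; field.
case: sgrP => [->|s0|s0] s1.
- rewrite (_ : (fun n => _) = fun=> 0); first exact: cvg_cst.
  by apply/funext; elim=> //= n ->; rewrite /sign_step; field.
- by apply: cvg_iter_sign_step_gt0.
- rewrite (_ : (fun n => _) = fun n => - iter n sign_step (- s)); last first.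
    by apply/funext => n; rewrite odd opprK.
  by apply: cvgN; apply: cvg_iter_sign_step_gt0 => //; lra.
Qed.

(** For large [n], [x / n.+1] lies in [(-pi, pi)], where the sine has the sign of
    its argument. *)
Lemma cvg_sg_sin_scaled x :
  Num.sg (sin (x / n.+1%:R)) @[n --> \oo] --> Num.sg x.
Proof.
wlog x0 : x / 0 < x.
  move=> H; case: (ltgtP x 0) => [xlt0|/H//|->].
    rewrite (_ : (fun n => _) = fun n => - Num.sg (sin (- x / n.+1%:R))); last first.
      by apply/funext => n; rewrite mulNr sinN sgrN opprK.
    by rewrite -[x in Num.sg x]opprK sgrN; apply: cvgN; apply: H; rewrite oppr_gt0.
  rewrite (_ : (fun n => _) = fun=> Num.sg 0); first exact: cvg_cst.
  by apply/funext => n; rewrite mul0r sin0.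
apply: cvg_near_cst; exists (Num.bound (x / pi)) => // n /= xn.
rewrite (gtr0_sg x0); apply: gtr0_sg; apply: sin_gt0_pi.
rewrite divr_gt0//= ltr_pdivrMr// mulrC -ltr_pdivrMr ?pi_gt0//.
apply: lt_le_trans (archi_boundP _) _; first by rewrite divr_ge0 ?pi_ge0 ?ltW.
by rewrite ler_nat (leq_trans xn).
Qed.

End sign_approximation.

(** * Uniqueness of characteristic functions *)

Section inner.
Variables (R : realType) (n : nat).
Implicit Types (u v x : 'cV[R]_n) (c : R).

Lemma innerDl u v x : inner (u + v) x = inner u x + inner v x.
Proof. by rewrite /inner -big_split/=; apply: eq_bigr => i _; rewrite mxE mulrDl. Qed.

Lemma innerNl u x : inner (- u) x = - inner u x.
Proof. by rewrite /inner -sumrN/=; apply: eq_bigr => i _; rewrite mxE mulNr. Qed.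

Lemma innerZl c u x : inner (c *: u) x = c * inner u x.
Proof. by rewrite /inner mulr_sumr/=; apply: eq_bigr => i _; rewrite mxE mulrA. Qed.

Lemma inner0l x : inner 0 x = 0.
Proof. by rewrite /inner big1// => i _; rewrite mxE mul0r. Qed.

Lemma inner_delta i x : inner (delta_mx i ord0) x = x i ord0.
Proof.
rewrite /inner (bigD1 i)//= big1 ?addr0 ?mxE ?eqxx ?mul1r// => j ji.
by rewrite mxE (negPf ji) mul0r.
Qed.

Lemma measurable_inner v : measurable_fun [set: 'cV[R]_n] (inner v).
Proof.
rewrite /inner; apply: measurable_sum => i; apply: measurable_funM => //.
exact: measurable_coord_cV.
Qed.

End inner.

Section characteristic_function_uniqueness.
Variables (R : realType) (n : nat).
Local Notation V := 'cV[R]_n.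
Implicit Types (f g : V -> R) (xi : V) (B : R).

(** Bounded limits may be taken of functions that are already limits, so this is
    the closure under iterated limits, for which induction proves that each
    function in it has the same expectation under two distributions with the
    same characteristic function. *)
Inductive trig_closure : (V -> R) -> Prop :=
| trig_cos xi : trig_closure (fun x => cos (inner xi x))
| trig_sin xi : trig_closure (fun x => sin (inner xi x))
| trig_add f g : trig_closure f -> trig_closure g ->
    trig_closure (fun x => f x + g x)
| trig_scale c f : trig_closure f -> trig_closure (fun x => c * f x)
| trig_lim (f_ : nat -> V -> R) f B : (forall k, trig_closure (f_ k)) ->
    (forall k x, `|f_ k x| <= B) -> (forall x, f_ ^~ x @ \oo --> f x) ->
    trig_closure f.

Lemma trig_bounded f : trig_closure f -> exists B, forall x, `|f x| <= B.
Proof.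
elim=> {f} [xi|xi|f g _ [B1 H1] _ [B2 H2]|c f _ [B H]|f_ f B _ _ fB ff].
- by exists 1 => x; exact: cos_max.
- by exists 1 => x; exact: sin_max.
- by exists (B1 + B2) => x; rewrite (le_trans (ler_normD _ _))// lerD.
- by exists (`|c| * B) => x; rewrite normrM ler_wpM2l.
- by exists B => x; apply: norm_lim_le (ff x) => k.
Qed.

Lemma trig_measurable f : trig_closure f -> measurable_fun [set: V] f.
Proof.
elim=> {f} [xi|xi|f g _ mf _ mg|c f _ mf|f_ f B _ mf _ ff].
- by apply: measurable_cos_comp; exact: measurable_inner.
- by apply: measurable_sin_comp; exact: measurable_inner.
- exact: measurable_funD.
- exact: measurable_funM.
- by apply: measurable_fun_cvg mf _ => x _; exact: ff.
Qed.

Lemma trig_integrable (P : probability V R) f : trig_closure f ->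
  P.-integrable [set: V] (EFin \o f).
Proof.
move=> tf; have [B fB] := trig_bounded tf.
by apply: bounded_integrable fB; exact: trig_measurable.
Qed.

Lemma trig_ext f g : f =1 g -> trig_closure f -> trig_closure g.
Proof. by move=> /funext ->. Qed.

Lemma trig_cst c : trig_closure (fun=> c).
Proof.
apply: trig_ext (trig_scale c (trig_cos 0)) => x.
by rewrite inner0l cos0 mulr1.
Qed.

Lemma trig_sub f g : trig_closure f -> trig_closure g ->
  trig_closure (fun x => f x - g x).
Proof.
move=> tf tg; apply: trig_ext (trig_add tf (trig_scale (-1) tg)) => x.
by rewrite mulN1r.
Qed.

(** Trigonometric functions multiply by linearization.  For a fixed trigonometric
    factor, the functions whose product with it is in the closure are stable
    under the closure operations, so they contain the closure; the same argument
    with a fixed factor in the closure concludes. *)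
Lemma trig_mul f g : trig_closure f -> trig_closure g ->
  trig_closure (fun x => f x * g x).
Proof.
have cosE u v x : cos (inner (u + v) x) + cos (inner (u - v) x) =
    2 * (cos (inner u x) * cos (inner v x)).
  by rewrite !innerDl innerNl cosD cosB; ring.
have sinE u v x : cos (inner (u - v) x) - cos (inner (u + v) x) =
    2 * (sin (inner u x) * sin (inner v x)).
  by rewrite !innerDl innerNl cosB cosD; ring.
have sincosE u v x : sin (inner (u + v) x) + sin (inner (u - v) x) =
    2 * (sin (inner u x) * cos (inner v x)).
  by rewrite !innerDl innerNl sinD sinB; ring.
have half (z : R) : 2^-1 * (2 * z) = z by rewrite mulrA mulVf ?mul1r.
(* If [h] may be multiplied by trigonometric functions, then by the closure. *)
have mulr h : (forall u, trig_closure (fun x => cos (inner u x) * h x)) ->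
    (forall u, trig_closure (fun x => sin (inner u x) * h x)) ->
    trig_closure h -> forall f, trig_closure f -> trig_closure (fun x => f x * h x).
  move=> hcos hsin th {f} f; have [C hC] := trig_bounded th.
  elim=> {f} [xi|xi|f1 f2 _ IH1 _ IH2|c f1 _ IH|f_ f1 B _ IH fB ff] //.
  - by apply: trig_ext (trig_add IH1 IH2) => x; rewrite mulrDl.
  - by apply: trig_ext (trig_scale c IH) => x; rewrite mulrA.
  - apply: (@trig_lim (fun k x => f_ k x * h x) _ (B * C)) => //.
      by move=> k x; rewrite normrM ler_pM.
    by move=> x; apply: cvgM; [exact: ff|exact: cvg_cst].
have tcos v : forall f, trig_closure f -> trig_closure (fun x => f x * cos (inner v x)).
  apply: mulr (trig_cos v) => u.
    apply: trig_ext (trig_scale 2^-1 (trig_add (trig_cos (u + v)) (trig_cos (u - v)))) => x.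
    by rewrite cosE half.
  apply: trig_ext (trig_scale 2^-1 (trig_add (trig_sin (u + v)) (trig_sin (u - v)))) => x.
  by rewrite sincosE half.
have tsin v : forall f, trig_closure f -> trig_closure (fun x => f x * sin (inner v x)).
  apply: mulr (trig_sin v) => u.
    apply: trig_ext (trig_scale 2^-1 (trig_add (trig_sin (v + u)) (trig_sin (v - u)))) => x.
    by rewrite sincosE half mulrC.
  apply: trig_ext (trig_scale 2^-1 (trig_sub (trig_cos (u - v)) (trig_cos (u + v)))) => x.
  by rewrite sinE half.
move=> tf tg; apply: mulr tf => //.
  by move=> u; apply: trig_ext (tcos u _ tg) => x; rewrite mulrC.
by move=> u; apply: trig_ext (tsin u _ tg) => x; rewrite mulrC.
Qed.

Lemma trig_sg f : trig_closure f -> (forall x, `|f x| <= 1) ->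
  trig_closure (fun x => Num.sg (f x)).
Proof.
move=> tf f1; apply: (@trig_lim (fun k x => iter k (@sign_step R) (f x)) _ 1).
- elim=> //= k IH; have c3 := trig_mul IH (trig_mul IH IH).
  apply: trig_ext (trig_scale 2^-1 (trig_sub (trig_scale 3 IH) c3)) => x.
  by rewrite /sign_step; field.
- by move=> k x; exact: iter_sign_step_le1.
- by move=> x; exact: cvg_iter_sign_step.
Qed.

(** The function [sg (sin ((x_i - a) / k.+1))] is a limit of polynomials in a
    trigonometric function, and it converges to [sg (x_i - a)] as [k] grows; the
    indicator of the half-space is [(sg + sg ^+ 2) / 2]. *)
Lemma trig_halfspace (i : 'I_n) a : trig_closure \1_[set x : V | a < x i ord0].
Proof.
have tsg : trig_closure (fun x => Num.sg (x i ord0 - a)).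
  apply: (@trig_lim (fun k x => Num.sg (sin ((x i ord0 - a) / k.+1%:R))) _ 1).
  - move=> k; apply: trig_sg => [|x]; last exact: sin_max.
    pose v : V := k.+1%:R^-1 *: delta_mx i ord0.
    apply: trig_ext (trig_sub (trig_scale (cos (a / k.+1%:R)) (trig_sin v))
      (trig_scale (sin (a / k.+1%:R)) (trig_cos v))) => x.
    by rewrite innerZl inner_delta mulrBl sinB [_^-1 * _]mulrC; ring.
  - by move=> k x; rewrite normr_sg; case: (_ != 0); rewrite ?normr0 ?normr1.
  - by move=> x; exact: cvg_sg_sin_scaled.
apply: trig_ext (trig_scale 2^-1 (trig_add tsg (trig_mul tsg tsg))) => x.
rewrite indicE; case: sgrP => [/eqP|xa|xa].
- rewrite subr_eq0 => /eqP xa; by rewrite memNset/= ?xa ?ltxx//; field.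
- by rewrite mem_set/= -1?subr_gt0//; field.
- by rewrite memNset/=; [field|apply/negP; rewrite -leNgt -subr_le0 ltW].
Qed.

(** The indicator of a union is the limit of
    [1 - \prod_(j < k) (1 - \1_(F j))], which the algebra structure provides. *)
Lemma trig_sigma_algebra : sigma_algebra [set: V] [set B | trig_closure \1_B].
Proof.
split=> /= [|B tB|F tF].
- by apply: trig_ext (trig_cst 0) => x; rewrite indic0.
- apply: trig_ext (trig_sub (trig_cst 1) tB) => x.
  rewrite !indicE setTD in_setC; case: (x \in B) => /=; ring.
- pose f k x : R := \prod_(j < k) (1 - \1_(F j) x).
  have tf k : trig_closure (f k).
    elim: k => [|k IH]; first by apply: trig_ext (trig_cst 1) => x; rewrite /f big_ord0.
    apply: trig_ext (trig_mul IH (trig_sub (trig_cst 1) (tF k))) => x.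
    by rewrite /f big_ord_recr.
  have tlim : trig_closure (fun x => 1 - \1_(\bigcup_k F k) x).
    apply: (trig_lim tf (B := 1)) => [k x|x].
      rewrite /f normr_prod; apply: prodr_ile1 => j _; rewrite normr_ge0/= indicE.
      by case: (x \in F j); rewrite ?subrr ?subr0 ?normr0 ?normr1.
    rewrite indicE; case: (boolP (x \in _)) => xF.
      move: xF; rewrite inE => -[k _ Fkx]; rewrite subrr; apply: cvg_near_cst.
      exists k.+1 => // j /= kj; rewrite /f (bigD1 (Ordinal kj))//= indicE mem_set//.
      by rewrite subrr mul0r.
    rewrite subr0; apply: cvg_near_cst; apply: nearW => k.
    rewrite /f big1// => j _; rewrite indicE memNset ?subr0// => Fjx.
    by move: xF; rewrite notin_setE; apply; exists j.
  by apply: trig_ext (trig_sub (trig_cst 1) tlim) => x; rewrite opprB addrC subrK.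
Qed.

(** The coordinates are measurable for the sigma-algebra generated by the
    half-spaces, hence so is the identity into the Borel space. *)
Lemma measurable_halfspaces :
  @measurable _ V `<=`
  <<s [set B | exists (i : 'I_n) (a : R), B = [set x : V | a < x i ord0]] >>.
Proof.
set G := [set B | _].
have mid : measurable_fun [set: g_sigma_algebraType G] (id : g_sigma_algebraType G -> V).
  apply: measurable_fun_cV => i.
  apply: (measurability _ (RGenOInfty.measurableE R)) => _ [_ [a ->] <-].
  rewrite setTI; apply: sub_sigma_algebra; exists i, a.
  by apply/seteqP; split => x; rewrite /= in_itv/= andbT.
by move=> B mB; have := mid measurableT B mB; rewrite setTI.
Qed.

Lemma trig_measurable_set (B : set V) : measurable B -> trig_closure \1_B.
Proof.
move=> /measurable_halfspaces.
apply: (smallest_sub trig_sigma_algebra) => _ [i [a ->]].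
exact: trig_halfspace.
Qed.

Lemma charfun_uniqueness (P1 P2 : probability V R) :
  (forall xi, \int[P1]_x cos (inner xi x) = \int[P2]_x cos (inner xi x)) ->
  (forall xi, \int[P1]_x sin (inner xi x) = \int[P2]_x sin (inner xi x)) ->
  forall B : set V, measurable B -> P1 B = P2 B.
Proof.
move=> ecos esin B mB.
have eq_int f : trig_closure f -> \int[P1]_x f x = \int[P2]_x f x.
  elim=> {f} [xi|xi|f g tf IHf tg IHg|c f tf IH|f_ f C tf IH fC ff] //.
  - by rewrite !RintegralD ?IHf ?IHg//; exact: trig_integrable.
  - by rewrite !RintegralZl ?IH//; exact: trig_integrable.
  - have mf k := trig_measurable (tf k).
    have c1 := cvg_bounded_Rintegral (P := P1) mf fC ff.
    have := cvg_bounded_Rintegral (P := P2) mf fC ff.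
    rewrite (_ : (fun k => _) = (fun k => \int[P1]_x f_ k x)); last first.
      by apply/funext => k; rewrite IH.
    by move/cvg_lim => <-//; rewrite (cvg_lim _ c1).
have fin_indic (P : probability V R) : P B = (\int[P]_x \1_B x)%:E.
  by rewrite fineK integral_indic// setIT// fin_num_measure.
by rewrite !fin_indic (eq_int _ (trig_measurable_set mB)).
Qed.

End characteristic_function_uniqueness.
(** * Analyticity of the real and imaginary parts *)

Section complex_parts.
Variable R : realType.
Implicit Types (z : R[i]) (f : R -> Cplx R).
Local Open Scope complex_scope.

Lemma normc_ge_Im z : `|complex.Im z|%:C <= `|z|.
Proof.
case: z => x y; rewrite normc_def lecE/= eqxx/= -sqrtr_sqr.
by rewrite ler_wsqrtr// lerDr sqr_ge0.
Qed.

Let analytic_part (p : R[i] -> R) f :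
  (forall z, `|p z|%:C <= `|z|) ->
  {morph p : x y / x + y} -> {morph p : x / - x} ->
  (forall z (y : R), p (z * y%:C) = p z * y) ->
  real_analytic f -> analytic (p \o f).
Proof.
move=> pn pD pN pM af x; have [a [r r0 ar]] := af x.
have p0 : p 0 = 0 by have := pM 0 0; rewrite mul0r mulr0.
exists (p \o a); exists r => // h hr.
have := ar (x + h); rewrite addrAC subrr add0r => /(_ hr) cv.
have pS n : p (series (fun k => a k * (h%:C : Cplx R) ^+ k) n) =
    series (fun k => (p \o a) k * h ^+ k) n.
  rewrite /series/= (big_morph p pD p0); apply: eq_bigr => i _.
  by rewrite -pM rmorphXn.
apply/cvgrPdist_lt => e e0; move/cvgrPdist_lt : cv => /(_ (e%:C)).
have eC : 0 < e%:C :> Cplx R by rewrite ltcR.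
move=> /(_ eC); apply: filterS => n /=; rewrite -pS -pN -pD => H.
by rewrite -ltcR; exact: le_lt_trans (pn _) H.
Qed.

Lemma analytic_Re f : real_analytic f -> analytic (fun x => complex.Re (f x)).
Proof.
apply: analytic_part.
- exact: normc_ge_Re.
- by case=> ? ? [].
- by case.
- by case=> a b x /=; rewrite mulr0 subr0.
Qed.

Lemma analytic_Im f : real_analytic f -> analytic (fun x => complex.Im (f x)).
Proof.
apply: analytic_part.
- exact: normc_ge_Im.
- by case=> ? ? [].
- by case.
- by case=> a b x /=; rewrite mulr0 add0r.
Qed.

End complex_parts.

(** * Analytic characteristic functions are determined by moments *)

Section finite_moments.
Context d (T : measurableType d) (R : realType).
Implicit Types (P : probability T R) (X Y f g : T -> R).

(** Even powers suffice to dominate all the others, and they avoid absolute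
    values. *)
Definition finite_moments P X := measurable_fun [set: T] X /\
  forall k, P.-integrable [set: T] (fun x => (X x ^+ k.*2)%:E).

Lemma finite_moments_cst P c : finite_moments P (fun=> c).
Proof. by split=> // k; exact: finite_measure_integrable_cst. Qed.

(** From [2 * (a * b) <= a ^+ 2 + b ^+ 2] with [a = X ^+ k.*2] and
    [b = Y ^+ k.*2]. *)
Lemma finite_moments_mul P X Y : finite_moments P X -> finite_moments P Y ->
  finite_moments P (fun x => X x * Y x).
Proof.
move=> [mX iX] [mY iY]; split=> [|k]; first exact: measurable_funM.
apply: (@integrable_le_norm _ _ _ _ _ (fun x => X x ^+ k.*2.*2 + Y x ^+ k.*2.*2)).
- by apply: measurable_funX; exact: measurable_funM.
- move=> x; rewrite exprMn -(muln2 k.*2) !exprM normrM.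
  set a := X x ^+ k.*2; set b := Y x ^+ k.*2.
  rewrite -[a ^+ 2]real_normK ?num_real// -[b ^+ 2]real_normK ?num_real//.
  by have := sqr_ge0 (`|a| - `|b|); have := sqr_ge0 `|a|; have := sqr_ge0 `|b|; nra.
- exact: (integrableD _ (iX _) (iY _)).
Qed.

Lemma finite_moments_prod P (I : Type) (s : seq I) (X : I -> T -> R) :
  (forall i, finite_moments P (X i)) ->
  finite_moments P (fun x => \prod_(i <- s) X i x).
Proof.
move=> fX; elim: s => [|i s IH].
  rewrite (_ : (fun x => _) = fun=> 1); first exact: finite_moments_cst.
  by apply/funext => x; rewrite big_nil.
rewrite (_ : (fun x => _) = fun x => X i x * \prod_(j <- s) X j x).
  exact: finite_moments_mul.
by apply/funext => x; rewrite big_cons.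
Qed.

Lemma finite_moments_integrable P X : finite_moments P X ->
  P.-integrable [set: T] (EFin \o X).
Proof.
move=> [mX iX]; apply: (@integrable_le_norm _ _ _ _ _ (fun x => 1 + X x ^+ 2)) => //.
- move=> x; rewrite -[X x ^+ 2]real_normK ?num_real//.
  by have := sqr_ge0 (`|X x| - 1); have := normr_ge0 (X x); nra.
- exact: (integrableD _ (finite_measure_integrable_cst _ 1 _) (iX 1%N)).
Qed.

Lemma finite_moments_exp P X N : finite_moments P X ->
  finite_moments P (fun x => X x ^+ N).
Proof.
move=> fX; elim: N => [|N IH]; first exact: finite_moments_cst.
by have := finite_moments_mul fX IH; under eq_fun do rewrite -exprS.
Qed.

Lemma integrable_EFin_sum P (I : Type) (s : seq I) (X : I -> T -> R) :
  (forall i, P.-integrable [set: T] (EFin \o X i)) ->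
  P.-integrable [set: T] (EFin \o (fun x => \sum_(i <- s) X i x)).
Proof.
move=> iX; rewrite (_ : _ \o _ = fun x => (\sum_(i <- s) (EFin \o X i) x)%E).
  by apply: integrable_sum.
by apply/funext => x; rewrite /= sumEFin.
Qed.

Lemma Rintegral_sum P (I : Type) (s : seq I) (X : I -> T -> R) :
  (forall i, P.-integrable [set: T] (EFin \o X i)) ->
  \int[P]_x (\sum_(i <- s) X i x) = \sum_(i <- s) \int[P]_x X i x.
Proof.
move=> iX.
have isum s' := integrable_EFin_sum s' iX.
elim: s => [|i s IH].
  rewrite big_nil (_ : (fun x => _) = fun=> 0) ?Rintegral_cst ?mul0r//.
  by apply/funext => x; rewrite big_nil.
rewrite big_cons -IH -RintegralD//; apply: eq_Rintegral => x _.
by rewrite big_cons.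
Qed.

(** The Taylor polynomial of [F] integrates to a combination of moments, which
    cancels in the difference, and the remainder integrates to
    [O(`|s| ^+ N)] with a constant given by the absolute moment of order [N]. *)
Lemma bounded_expands_flat P1 P2 (F : R -> R) a X N :
  (forall r, expands a r F) -> (forall y, `|F y| <= 1) -> continuous F ->
  finite_moments P1 X -> finite_moments P2 X ->
  (forall k, \int[P1]_x X x ^+ k = \int[P2]_x X x ^+ k) ->
  exists K, forall s,
    `|\int[P1]_x F (s * X x) - \int[P2]_x F (s * X x)| <= K * `|s| ^+ N.
Proof.
move=> aF F1 cF fX1 fX2 eqm; have [K HK] := bounded_expands_remainder N aF F1.
pose m P := \int[P]_x `|X x| ^+ N.
pose S s x := \sum_(0 <= k < N) a k * s ^+ k * X x ^+ k.
have rem P : finite_moments P X -> forall s,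
    `|\int[P]_x F (s * X x) - \int[P]_x S s x| <= K * m P * `|s| ^+ N.
  move=> fX s.
  have mFX : measurable_fun [set: T] (fun x => F (s * X x)).
    apply: measurableT_comp; first exact: continuous_measurable_fun.
    by apply: measurable_funM => //; case: fX.
  have iFX := bounded_integrable P mFX (fun x => F1 _).
  have iX k : P.-integrable [set: T] (EFin \o (fun x => a k * s ^+ k * X x ^+ k)).
    exact: (integrableZl _ (a k * s ^+ k)
      (finite_moments_integrable (finite_moments_exp k fX))).
  have iS : P.-integrable [set: T] (EFin \o S s).
    exact: integrable_EFin_sum.
  have iN : P.-integrable [set: T] (EFin \o (fun x => `|X x| ^+ N)).
    have := integrable_norm (finite_moments_integrable (finite_moments_exp N fX)).
    by apply: eq_integrable => // x _ /=; rewrite normrX.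
  rewrite -RintegralB//; apply: le_trans (le_normr_Rintegral _ _) _ => //.
    exact: (integrableB _ iFX iS).
  rewrite mulrAC -RintegralZl//; apply: le_Rintegral => //.
  - exact: integrable_norm (integrableB _ iFX iS).
  - exact: (integrableZl _ _ iN).
  move=> x _; rewrite -mulrA -exprMn -normrM.
  rewrite (_ : S s x = \sum_(0 <= k < N) a k * (s * X x) ^+ k)//.
  by apply: eq_bigr => k _; rewrite exprMn mulrA.
have eqS s : \int[P1]_x S s x = \int[P2]_x S s x.
  rewrite /S !Rintegral_sum; last first.
  - by move=> k; exact: (integrableZl _ (a k * s ^+ k)
      (finite_moments_integrable (finite_moments_exp k fX1))).
  - by move=> k; exact: (integrableZl _ (a k * s ^+ k)
      (finite_moments_integrable (finite_moments_exp k fX2))).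
  apply: eq_bigr => k _; rewrite !RintegralZl ?eqm//.
  - exact: (finite_moments_integrable (finite_moments_exp k fX2)).
  - exact: (finite_moments_integrable (finite_moments_exp k fX1)).
exists (K * m P1 + K * m P2) => s.
have h1 := rem _ fX1 s; have h2 := rem _ fX2 s; rewrite eqS in h1.
rewrite mulrDl; set A := \int[P1]_x _ in h1 *; set B := \int[P2]_x F _ in h2 *.
set C := \int[P2]_x S s x in h1 h2.
rewrite (_ : A - B = (A - C) - (B - C)); last by ring.
by apply: le_trans (ler_normB _ _) _; exact: lerD.
Qed.

(** To be used with [F] the cosine or the sine.  The difference of the two sides,
    as a function of the scale [s], is analytic and flat at [0]; the conclusion
    is its value at [s = 1]. *)
Lemma eq_integral_analytic P1 P2 (F : R -> R) a X :
  (forall r, expands a r F) -> (forall y, `|F y| <= 1) -> continuous F ->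
  finite_moments P1 X -> finite_moments P2 X ->
  (forall k, \int[P1]_x X x ^+ k = \int[P2]_x X x ^+ k) ->
  analytic (fun s => \int[P1]_x F (s * X x)) ->
  analytic (fun s => \int[P2]_x F (s * X x)) ->
  \int[P1]_x F (X x) = \int[P2]_x F (X x).
Proof.
move=> aF F1 cF fX1 fX2 eqm an1 an2.
have /(congr1 (fun g : R -> R => g 1)) /eqP := analytic_flat (analyticB an1 an2)
  (fun N => bounded_expands_flat N aF F1 cF fX1 fX2 eqm).
rewrite subr_eq0 => /eqP.
under eq_Rintegral do rewrite mul1r.
by under [RHS]eq_Rintegral do rewrite mul1r.
Qed.

End finite_moments.
(** * Moments as polynomials in the direction *)

Section moment_polynomial.
(* The algebraic structures of [mpoly] without its notations, which clash. *)
Import (canonicals) mpoly.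
Variables (R : realType) (n : nat).
Local Notation V := 'cV[R]_n.
Implicit Types (P : probability V R) (v : V).

(** Expansion over all words of [N] indices, with repetitions; collecting equal
    monomials would bring multinomial coefficients. *)
Lemma inner_expn v (x : V) N : inner v x ^+ N =
  \sum_(f : {ffun 'I_N -> 'I_n})
    (\prod_j v (f j) ord0) * \prod_j x (f j) ord0.
Proof.
rewrite -[N in LHS]card_ord -prodr_const bigA_distr_bigA/=.
by apply: eq_bigr => f _; rewrite big_split.
Qed.

Lemma moment_polynomial P N :
  (forall i, finite_moments P (fun x => x i ord0)) ->
  exists p : mpoly.mpoly n R, forall v,
    mpoly.meval (fun i => v i ord0) p = \int[P]_x inner v x ^+ N.
Proof.
move=> fP; pose mono (f : {ffun 'I_N -> 'I_n}) (x : V) := \prod_j x (f j) ord0.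
have imono f : P.-integrable [set: V] (EFin \o mono f).
  by apply: finite_moments_integrable; apply: finite_moments_prod => j.
exists (\sum_(f : {ffun 'I_N -> 'I_n})
  (\int[P]_x mono f x) *: \prod_j mpoly.mpolyX R (mpoly.mnm1 (f j))) => v.
rewrite raddf_sum/=; under [RHS]eq_Rintegral do rewrite inner_expn.
rewrite Rintegral_sum => [|f]; last exact: (integrableZl _ _ (imono f)).
apply: eq_bigr => f _; rewrite mpoly.mevalZ RintegralZl//; last exact: imono.
rewrite mulrC; congr (_ * _).
by rewrite rmorph_prod; apply: eq_bigr => j _; exact: mpoly.mevalXU.
Qed.

(** The polynomial is the difference of the two polynomials given by
    [moment_polynomial]. *)
Lemma equal_moment_variety P1 P2 N :
  (forall i, finite_moments P1 (fun x => x i ord0)) ->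
  (forall i, finite_moments P2 (fun x => x i ord0)) ->
  algebraic_variety
    [set v : V | \int[P1]_x inner v x ^+ N = \int[P2]_x inner v x ^+ N].
Proof.
move=> /(moment_polynomial N)[p1 hp1] /(moment_polynomial N)[p2 hp2].
exists (p1 - p2); apply/seteqP; split => v /=; rewrite mpoly.mevalB hp1 hp2.
  by move=> ->; rewrite subrr.
by move/eqP; rewrite subr_eq0 => /eqP.
Qed.

End moment_polynomial.

(** * Moments seen through the output *)

Section observable_moments.
Variables (R : realType) (n m : nat).

Lemma measurable_mulmx (M : 'M[R]_(m, n)) :
  measurable_fun [set: 'cV[R]_n] (fun x => M *m x).
Proof.
apply: measurable_fun_cV => i.
rewrite (_ : (fun x => _) = fun x : 'cV[R]_n => \sum_j M i j * x j ord0).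
  apply: measurable_sum => j; apply: measurable_funM => //.
  exact: measurable_coord_cV.
by apply/funext => x; rewrite mxE.
Qed.

Lemma inner_tr_mulmx (M : 'M[R]_(m, n)) w x :
  inner (M^T *m w) x = inner w (M *m x).
Proof.
have innerE k (u y : 'cV[R]_k) : inner u y = (u^T *m y) ord0 ord0.
  by rewrite mxE; apply: eq_bigr => i _; rewrite mxE.
by rewrite !innerE trmx_mul trmxK mulmxA.
Qed.

(** A direction seen at time [t] is [M^T *m w] with [M = C e^(tA)], and
    [inner (M^T *m w) x = inner w (M *m x)] depends on [x] only through the
    output. *)
Lemma eq_moment_of_output (A : 'M[R]_n) (C : 'M[R]_(m, n))
    (P1 P2 : probability 'cV[R]_n R) v N :
  observable_directions A C v ->
  finite_moments P1 (inner v) -> finite_moments P2 (inner v) ->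
  (forall t : R, 0 <= t -> forall B : set 'cV[R]_m, measurable B ->
     output_distribution A C P1 t B = output_distribution A C P2 t B) ->
  \int[P1]_x inner v x ^+ N = \int[P2]_x inner v x ^+ N.
Proof.
move=> [t /= t0]; rewrite orthogonal_compl_kernel => -[w _ <-] f1 f2 /(_ t t0).
rewrite /output_distribution; set M := C *m _ in f1 f2 * => eqP.
have mM := measurable_mulmx M.
have mw : measurable_fun [set: 'cV[R]_m] (fun y => (inner w y ^+ N)%:E).
  by apply/measurable_EFinP; apply: measurable_funX; exact: measurable_inner.
have toM (P : probability 'cV[R]_n R) : finite_moments P (inner (M^T *m w)) ->
    (\int[P]_x (inner (M^T *m w) x ^+ N)%:E =
     \int[pushforward P (fun x => M *m x)]_y (inner w y ^+ N)%:E)%E.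
  move=> fP; rewrite (integral_pushforward mM mw)//; last first.
    have := finite_moments_integrable (finite_moments_exp N fP).
    by apply: eq_integrable => // x _ /=; rewrite inner_tr_mulmx.
  by apply: eq_integral => x _ /=; rewrite inner_tr_mulmx.
rewrite /Rintegral !toM//; congr fine.
by apply: eq_measure_integral => B mB _; exact: eqP.
Qed.

End observable_moments.

Lemma charfun_scale_Re (R : realType) n (P : probability 'cV[R]_n R) s v :
  complex.Re (charfun P (s *: v)) = \int[P]_x cos (s * inner v x).
Proof. by apply: eq_Rintegral => x _; rewrite /= innerZl. Qed.

Lemma charfun_scale_Im (R : realType) n (P : probability 'cV[R]_n R) s v :
  complex.Im (charfun P (s *: v)) = \int[P]_x sin (s * inner v x).
Proof. by apply: eq_Rintegral => x _; rewrite /= innerZl. Qed.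

(** The real part of the characteristic function along [v], at the origin, is all
    that [even_moment_integrable] asks for. *)
Lemma finite_moments_inner (R : realType) n (P : probability 'cV[R]_n R) v :
  real_analytic (fun s : R => charfun P (s *: v)) -> finite_moments P (inner v).
Proof.
move=> /analytic_Re/(_ 0)[a [r r0 ar]]; split; first exact: measurable_inner.
move=> k; apply: (@even_moment_integrable _ _ _ P _ a r k _ r0); first exact: measurable_inner.
move=> h hr; have := ar h hr; rewrite add0r.
by rewrite charfun_scale_Re.
Qed.

Theorem theorem7 (R : realType) (n m : nat)
    (A : 'M[R]_n) (C : 'M[R]_(m, n)) :
  ~ (exists V : set 'cV[R]_n,
       [/\ algebraic_variety V, V <> [set: 'cV[R]_n] &
           observable_directions A C `<=` V]) ->
  ensemble_observable A C
    [set P : probability 'cV[R]_n R |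
      forall v : 'cV[R]_n, v != 0 ->
        real_analytic (fun s : R => charfun P (s *: v))].
Proof.
move=> noV P1 P2 /= K1 K2 _ _ eq_out.
have fm (P : probability 'cV[R]_n R) v :
    (forall v : 'cV[R]_n, v != 0 -> real_analytic (fun s : R => charfun P (s *: v))) ->
    finite_moments P (inner v).
  have [->|v0] := eqVneq v 0; last by move=> /(_ v v0)/finite_moments_inner.
  by move=> _; rewrite (funext (@inner0l R n)); exact: finite_moments_cst.
have coord (P : probability 'cV[R]_n R) i : (forall v, finite_moments P (inner v)) ->
    finite_moments P (fun x => x i ord0).
  by move=> /(_ (delta_mx i ord0)); rewrite (funext (inner_delta i)).
have f1 v := fm P1 v K1; have f2 v := fm P2 v K2.
have eq_mom v N : \int[P1]_x inner v x ^+ N = \int[P2]_x inner v x ^+ N.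
  apply: contrapT => ne; apply: noV.
  exists [set u | \int[P1]_x inner u x ^+ N = \int[P2]_x inner u x ^+ N]; split.
  - by apply: equal_moment_variety => i; exact: coord.
  - by move=> /seteqP[_ VT]; apply: ne; exact: VT.
  - by move=> u Du; exact: (eq_moment_of_output N Du (f1 u) (f2 u) eq_out).
apply: charfun_uniqueness => v; have [->|v0] := eqVneq v 0.
- under eq_Rintegral do rewrite inner0l.
  under [RHS]eq_Rintegral do rewrite inner0l.
  by rewrite !Rintegral_probability_cst.
- refine (eq_integral_analytic (@expands_cos R) (@cos_max R) (@continuous_cos R)
    (f1 v) (f2 v) (eq_mom v) _ _).
  + by under eq_fun do rewrite -charfun_scale_Re; exact: analytic_Re (K1 v v0).
  + by under eq_fun do rewrite -charfun_scale_Re; exact: analytic_Re (K2 v v0).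
- under eq_Rintegral do rewrite inner0l.
  under [RHS]eq_Rintegral do rewrite inner0l.
  by rewrite !Rintegral_probability_cst.
- refine (eq_integral_analytic (@expands_sin R) (@sin_max R) (@continuous_sin R)
    (f1 v) (f2 v) (eq_mom v) _ _).
  + by under eq_fun do rewrite -charfun_scale_Im; exact: analytic_Im (K1 v v0).
  + by under eq_fun do rewrite -charfun_scale_Im; exact: analytic_Im (K2 v v0).
Qed.
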